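(* Let $G$ be a connected graph. Then $\mu_{\rm t}(G)=1$ if and only if $G$ has at least one bypass vertex and every two distinct bypass vertices $v_1,v_2$ of $G$ satisfy: there exist nonadjacent vertices $u_1,u_2$ with $N_G(u_1)\cap N_G(u_2)=\{v_1,v_2\}$.
   Context: For $X\subseteq V(G)$, two vertices $x,y$ are $X$-visible if there is a shortest $x,y$-path in $G$ with no internal vertex in $X$; $X$ is a total mutual-visibility set if any two vertices of $V(G)$ are $X$-visible, and $\mu_{\rm t}(G)$ is the maximum cardinality of such a set. A vertex $v$ is a bypass vertex if $v$ is not the central vertex of a convex path on three vertices, i.e., there are no two nonadjacent vertices $u,w$ whose only common neighbour is $v$. (A subgraph $H$ is convex if all shortest paths in $G$ between vertices of $H$ lie in $H$.) $N_G(u)$ denotes the neighbourhood of $u$. *)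

(* Defs.v *)
From mathcomp Require Import all_boot.
From mathcomp Require Import boolp.

Set Implicit Arguments.
Unset Strict Implicit.
Unset Printing Implicit Defensive.

(* A simple graph is a symmetric irreflexive relation [e] on a [finType]. *)
Section Graph.
Variables (T : finType) (e : rel T).

Definition connected_graph : Prop := forall x y, connect e x y.

Definition nbh (x : T) : {set T} := [set y | e x y].

(* As in [path.v], the walk [x :: p] is represented by [x] and [p]; its length
   is [size p] and its endpoint is [last x p]. *)
Definition walk (x y : T) (p : seq T) : Prop := path e x p /\ last x p = y.

(* A walk of minimum length has no repeated vertex, so it is a path. *)
Definition shortest_path (x y : T) (p : seq T) : Prop :=
  walk x y p /\ forall q, walk x y q -> size p <= size q.

(* [x :: p] without its first and last items. *)
Definition internal (x : T) (p : seq T) : seq T := behead (belast x p).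

Definition visible (X : {set T}) (x y : T) : Prop :=
  exists2 p, shortest_path x y p & {in internal x p, forall z, z \notin X}.

Definition total_mutual_visibility (X : {set T}) : Prop :=
  forall x y, visible X x y.

Definition mu_t : nat :=
  \max_(X : {set T} | `[< total_mutual_visibility X >]) #|X|.

(* The subgraph with vertex set [S] and edge relation [h]. *)
Definition convex_subgraph (S : {set T}) (h : rel T) : Prop :=
  forall x y p, x \in S -> y \in S -> shortest_path x y p ->
    {subset x :: p <= S} /\ path h x p.

(* The edge relation of the path u - v - w. *)
Definition p3_edge (u v w : T) : rel T :=
  [rel x y | (x, y) \in [:: (u, v); (v, u); (v, w); (w, v)]].

Definition convex_p3 (u v w : T) : Prop :=
  [/\ uniq [:: u; v; w], e u v, e v w &
      convex_subgraph [set u; v; w] (p3_edge u v w)].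

Definition bypass (v : T) : Prop := ~ exists u w, convex_p3 u v w.

Hypotheses (e_sym : symmetric e) (e_irr : irreflexive e).

Lemma convex_p3P (u v w : T) :
  convex_p3 u v w <->
  [/\ u != w, ~~ e u w & nbh u :&: nbh w = [set v]].
Proof.
have edge_sp x y : e x y -> shortest_path x y [:: y].
  move=> exy; split; first by split=> //=; rewrite exy.
  by case=> // -[_ /= xy]; move: exy; rewrite xy e_irr.
have two_sp x z y : x != y -> ~~ e x y -> e x z -> e z y ->
    shortest_path x y [:: z; y].
  move=> xy nexy exz ezy; split; first by split=> //=; rewrite exz ezy.
  case=> [|a [|b q]] // [/= pq lq]; first by rewrite lq eqxx in xy.
  by rewrite -lq (andP pq).1 in nexy.
split.
- case=> /= /and3P[]; rewrite !inE negb_or => /andP[uv uw] vw _ euv evw cvx.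
  have Su : u \in [set u; v; w] by rewrite !inE eqxx.
  have Sw : w \in [set u; v; w] by rewrite !inE eqxx !orbT.
  have neuw : ~~ e u w.
    apply/negP=> /edge_sp /(cvx _ _ _ Su Sw)[_] /=.
    rewrite andbT /p3_edge /= !inE !xpair_eqE !eqxx /=.
    by rewrite (negPf uv) (negPf uw) eq_sym (negPf vw).
  split=> //; apply/setP=> z; rewrite !inE; apply/andP/eqP => [[euz ewz]|->].
    have [|sub _] := cvx _ _ _ Su Sw (two_sp u z w uw neuw euz _).
      by rewrite e_sym.
    have := sub z; rewrite !inE eqxx orbT => /(_ isT) /orP[/orP[]|] /eqP zE //.
      by rewrite zE e_irr in euz.
    by rewrite zE e_irr in ewz.
  by rewrite euv e_sym.
- case=> uw neuw Nuw.
  have /andP[euv ewv] : e u v && e w v.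
    by move/setP: Nuw => /(_ v); rewrite !inE eqxx.
  have com z : e u z -> e w z -> z = v.
    by move=> a b; move/setP: Nuw => /(_ z); rewrite !inE a b => /esym/eqP.
  have neq a b : e a b -> a != b.
    by move=> eab; apply/eqP=> ab; rewrite ab e_irr in eab.
  have evw : e v w by rewrite e_sym.
  have evu : e v u by rewrite e_sym.
  have newu : ~~ e w u by rewrite e_sym.
  split=> //=; first by rewrite !inE negb_or uw !neq.
  have base x y q : shortest_path x y q -> x = y -> q = [::].
    by move=> [_ m] xy; apply/nilP; rewrite /nilp -leqn0 (m [::]).
  have one x y q : shortest_path x y q -> e x y -> q = [:: y].
    move=> [[pq lq] m] exy; have := m [:: y] (edge_sp _ _ exy).1.
    case: q pq lq {m} => [|a [|b q]] //= _ lq _; last by rewrite -lq.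
    by rewrite lq e_irr in exy.
  have two x y q : shortest_path x y q -> x != y -> ~~ e x y -> e x v ->
      e v y -> exists2 z, q = [:: z; y] & e x z && e z y.
    move=> [[pq lq] m] xy nexy exv evy.
    have := m [:: v; y] (two_sp _ _ _ xy nexy exv evy).1.
    case: q pq lq {m} => [|a [|b [|c q]]] //= pq lq _.
    - by rewrite lq eqxx in xy.
    - by rewrite -lq (andP pq).1 in nexy.
    - by exists a; rewrite -?lq //; case/and3P: pq => -> ->.
  move=> x y q; rewrite !inE => Sx Sy sp.
  have sol z : e x z -> e z y -> (x == u) && (y == w) || (x == w) && (y == u) ->
    z = v.
    move=> xz zy /orP[] /andP[/eqP xE /eqP yE]; apply: com.
    - by rewrite -xE.
    - by rewrite -yE e_sym.
    - by rewrite -yE e_sym.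
    - by rewrite -xE.
  case: (eqVneq x y) => [xy|nxy].
    rewrite (base _ _ _ sp xy); split=> // z; rewrite inE => /eqP->.
    by rewrite !inE.
  case exy: (e x y).
    rewrite (one _ _ _ sp exy) /= andbT; split.
      by move=> z; rewrite !inE => /orP[] /eqP->.
    rewrite /p3_edge /= !inE !xpair_eqE.
    move: Sx Sy nxy exy.
    move=> /orP[/orP[]|] /eqP-> /orP[/orP[]|] /eqP->;
      by rewrite ?eqxx ?orbT //= ?(negPf neuw) ?(negPf newu).
  have xvy : (x == u) && (y == w) || (x == w) && (y == u).
    move: Sx Sy nxy exy.
    move=> /orP[/orP[]|] /eqP-> /orP[/orP[]|] /eqP->;
      by rewrite ?eqxx ?orbT ?euv ?evu ?evw ?ewv.
  have [exv evy] : e x v /\ e v y.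
    by case/orP: xvy => /andP[/eqP-> /eqP->].
  have [z -> /andP[exz ezy]] := two _ _ _ sp nxy (negbT exy) exv evy.
  rewrite (sol z exz ezy xvy); split.
    move=> t; rewrite !inE => /or3P[] /eqP->; rewrite ?eqxx ?orbT //.
  by case/orP: xvy => /andP[/eqP-> /eqP->];
    rewrite /p3_edge /= !inE !xpair_eqE !eqxx /= ?orbT.
Qed.

End Graph.

(* Main.v *)
Require Import Defs.
From mathcomp Require Import all_boot.
From mathcomp Require Import boolp.

(** Given a shortest path x, a, b, ... and a common neighbour a' of x and b
    outside X, replacing a by a' keeps the path shortest; sweeping along the
    path, one sees that X is a total mutual-visibility set as soon as every two
    vertices at distance 2 have a common neighbour outside X.  So X fails
    exactly when it contains a nonempty common neighbourhood of two nonadjacent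
    vertices.  Thus {v} fails exactly when v is not a bypass vertex, and, for
    bypass vertices v1 and v2, {v1, v2} fails exactly when it is such a common
    neighbourhood.  As the property is inherited by subsets, only sets
    of size 1 and 2 decide whether the maximum is 1. *)

Section TotalMutualVisibility.
Variables (T : finType) (e : rel T).
Implicit Types (x y u v w : T) (p : seq T) (X Y : {set T}).

Lemma shortest_path_exists x y : connect e x y -> exists p, shortest_path e x y p.
Proof.
move=> /connectP[p0 xp0 yE].
have ex : exists n, `[< exists2 p, walk e x y p & size p = n >].
  by exists (size p0); apply/asboolP; exists p0.
case: (ex_minnP ex) => n /asboolP[p xpy <-] min_p.
by exists p; split=> // q xqy; apply: min_p; apply/asboolP; exists q.
Qed.

Lemma shortest_path_size x y p q :
  shortest_path e x y p -> walk e x y q -> size q = size p -> shortest_path e x y q.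
Proof. by move=> [_ min_p] xqy sqp; split=> // r /min_p; rewrite sqp. Qed.

Lemma shortest_path_behead x y a p :
  shortest_path e x y (a :: p) -> shortest_path e a y p.
Proof.
move=> [[/= /andP[xa ap] lp] min_p]; split=> // q [aq lq].
by apply: (min_p (a :: q)); split; rewrite //= xa.
Qed.

(** Either failure would give a shortcut past [a]. This makes the non-visibility condition
    applicable to the pair [x], [b]. *)
Lemma shortest_path_dist2 x y a b p :
  shortest_path e x y [:: a, b & p] -> x != b /\ ~~ e x b.
Proof.
move=> [[/= /and3P[_ _ bp] lp] min_p]; split; apply/negP.
- move=> /eqP xb; have/min_p : walk e x y p by rewrite xb.
  by rewrite /= ltnNge leqnSn.
- move=> xb; have/min_p : walk e x y (b :: p) by split; rewrite //= xb.
  by rewrite /= ltnn.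
Qed.

Hypothesis e_sym : symmetric e.

Lemma visible_of_shortest_path X x y p :
    (forall u w, u != w -> ~~ e u w ->
       nbh e u :&: nbh e w \subset X -> nbh e u :&: nbh e w = set0) ->
  shortest_path e x y p -> visible e X x y.
Proof.
(* The start vertex must vary in the induction: after the swap the sweep continues from [a'], not
   from [a]. *)
move=> noX; have [n] := ubnP (size p).
elim: n x p => // n IHn x [|a [|b p]] /= le_n sp.
- by exists [::].
- by exists [:: a].
have [xNb xNeb] := shortest_path_dist2 _ _ _ _ _ sp.
have [[/= /and3P[xa ab bp] lp] _] := sp.
have : ~~ (nbh e x :&: nbh e b \subset X).
  apply/negP=> /(noX _ _ xNb xNeb)/setP/(_ a).
  by rewrite !inE xa e_sym ab.
case/subsetPn=> a'; rewrite !inE (e_sym b) => /andP[xa' a'b] a'X.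
have sp' : shortest_path e x y [:: a', b & p].
  by apply: (shortest_path_size _ _ _ _ sp) => //; split; rewrite //= xa' a'b.
have sp_tl := shortest_path_behead _ _ _ _ sp'.
have [q sq qX] := IHn a' (b :: p) le_n sp_tl.
(* Both are shortest from [a'] to [y], so [q] can replace the old tail without lengthening the
   path. *)
have q_size : size q = size (b :: p).
  by apply/eqP; rewrite eqn_leq (sq.2 _ sp_tl.1) (sp_tl.2 _ sq.1).
exists (a' :: q).
  have [[a'q lq] _] := sq.
  apply: (shortest_path_size _ _ _ _ sp'); last by rewrite /= q_size.
  by split; rewrite //= xa'.
case: q qX q_size {sq} => // c q qX _ z.
by rewrite [internal _ _]/= inE => /orP[/eqP-> | /qX].
Qed.

Hypotheses (e_irr : irreflexive e) (e_conn : connected_graph e).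

Lemma total_mutual_visibilityP X :
  total_mutual_visibility e X <->
  (forall u w, u != w -> ~~ e u w ->
     nbh e u :&: nbh e w \subset X -> nbh e u :&: nbh e w = set0).
Proof.
split=> [visX u w uw uNw subX | noX x y]; last first.
  have [p sp] := shortest_path_exists x y (e_conn x y).
  exact: visible_of_shortest_path sp.
apply/setP=> z; rewrite !inE; apply/negP=> /andP[uz wz].
have [p [[up lp] min_p] pX] := visX u w.
(* The walk through [z] bounds the distance by 2, so the visible path has exactly one internal
   vertex: a common neighbour outside [X]. *)
have/min_p : walk e u w [:: z; w] by split; rewrite //= uz e_sym wz.
case: p up lp pX {min_p} => [_ /= uwE|a [/andP[ua _] /= aw|b [|//]]].
- by rewrite uwE eqxx in uw.
- by rewrite -aw ua in uNw.
- move=> /= /and3P[ua ab _] bw /(_ a); rewrite inE eqxx => /(_ isT)/negP aX _.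
  by apply/aX/(subsetP subX); rewrite !inE ua e_sym -bw ab.
Qed.

Lemma total_mutual_visibilityS X Y :
  Y \subset X -> total_mutual_visibility e X -> total_mutual_visibility e Y.
Proof.
by move=> YX visX x y; have [p sp pX] := visX x y; exists p => // z /pX;
  apply/contra/(subsetP YX).
Qed.

Lemma total_mutual_visibility1 v : total_mutual_visibility e [set v] <-> bypass e v.
Proof.
rewrite total_mutual_visibilityP; split=> [no_v [u [w]] | bv u w uw uNw].
  rewrite convex_p3P // => -[uw uNw Nv].
  have := no_v u w uw uNw; rewrite Nv => /(_ (subxx _))/setP/(_ v).
  by rewrite !inE eqxx.
rewrite subset1 => /orP[/eqP Nv | /eqP//].
by case: bv; exists u, w; apply/convex_p3P.
Qed.

Lemma total_mutual_visibility2 v1 v2 : bypass e v1 -> bypass e v2 ->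
  total_mutual_visibility e [set v1; v2] <->
  ~ exists u1 u2 : T,
      [/\ u1 != u2, ~~ e u1 u2 & nbh e u1 :&: nbh e u2 = [set v1; v2]].
Proof.
move=> /total_mutual_visibility1/total_mutual_visibilityP b1.
move=> /total_mutual_visibility1/total_mutual_visibilityP b2.
rewrite total_mutual_visibilityP; split=> [no12 [u [w [uw uNw N12]]] | no12 u w uw uNw].
  have := no12 u w uw uNw; rewrite N12 => /(_ (subxx _))/setP/(_ v1).
  by rewrite !inE eqxx.
set N := nbh e u :&: nbh e w => N12.
(* If [N] misses one of [v1], [v2], it lies in the other singleton, and the bypass condition there
   makes it empty. *)
have sub1 a b : N \subset [set a; b] -> a \notin N -> N \subset [set b].
  move=> /subsetP Nab aN; apply/subsetP=> z zN.
  have := Nab z zN; rewrite !inE => /orP[/eqP za | //].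
  by rewrite -za zN in aN.
have [v1N | /(sub1 _ _ N12)] := boolP (v1 \in N); last exact: b2.
have [v2N | v2N] := boolP (v2 \in N); last first.
  by apply: b1 => //; apply: sub1 v2N; rewrite setUC.
case: no12; exists u, w; split=> //; apply/eqP.
by rewrite eqEsubset N12 subUset !sub1set v1N v2N.
Qed.

Lemma leq_mu_t X : total_mutual_visibility e X -> #|X| <= mu_t e.
Proof. by move=> visX; apply: leq_bigmax_cond; apply/asboolP. Qed.

Lemma mu_t_attained : exists2 X, total_mutual_visibility e X & #|X| = mu_t e.
Proof.
(* A maximum is attained only over a nonempty family; [set0] provides a member. *)
have vis0 : total_mutual_visibility e set0.
  by apply/total_mutual_visibilityP=> u w _ _; rewrite subset0 => /eqP.
have [|X /asboolP visX maxX] := @eq_bigmax_cond _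
    [pred X : {set T} | `[< total_mutual_visibility e X >]] (fun X => #|X|).
  by apply/card_gt0P; exists set0; apply/asboolP.
by exists X.
Qed.

End TotalMutualVisibility.

Theorem theorem5p3 (T : finType) (e : rel T)
    (e_sym : symmetric e) (e_irr : irreflexive e)
    (e_conn : connected_graph e) :
  mu_t e = 1 <->
  (exists v : T, bypass e v) /\
  (forall v1 v2 : T, bypass e v1 -> bypass e v2 -> v1 != v2 ->
     exists u1 u2 : T,
       [/\ u1 != u2, ~~ e u1 u2 & nbh e u1 :&: nbh e u2 = [set v1; v2]]).
Proof.
have vis1 v := total_mutual_visibility1 T e e_sym e_irr e_conn v.
have vis2 v1 v2 := total_mutual_visibility2 T e e_sym e_irr e_conn v1 v2.
have [X visX cardX] := mu_t_attained T e e_sym e_conn.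
split=> [mu1 | [[v bv] pairs]].
  split=> [|v1 v2 b1 b2 v12].
    have/cards1P[v Xv] : #|X| == 1 by rewrite cardX mu1.
    by exists v; apply/vis1; rewrite -Xv.
  (* Without such [u1], [u2], the pair would be a total mutual-visibility set of size 2. *)
  apply: contrapT => /(vis2 _ _ b1 b2)/leq_mu_t.
  by rewrite mu1 cards2 v12.
apply/eqP; rewrite eqn_leq; apply/andP; split; last first.
  by rewrite -(cards1 v); apply/leq_mu_t/vis1.
(* Two elements of a larger [X] are bypass vertices by heredity, and so is their pair visible,
   against [pairs]. *)
rewrite leqNgt -cardX; apply/negP=> /card_gt1P[v1 [v2 [v1X v2X v12]]].
have bX w : w \in X -> bypass e w.
  by move=> wX; apply/vis1/(total_mutual_visibilityS _ _ _ _ _ visX); rewrite sub1set.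
have [b1 b2] := (bX _ v1X, bX _ v2X).
apply: ((vis2 _ _ b1 b2).1 _ (pairs _ _ b1 b2 v12)).
by apply: total_mutual_visibilityS visX; rewrite subUset !sub1set v1X.
Qed.
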